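(* Let $K_1,K_2$ be two disjoint convex hypersurfaces in $\mathbb{R}^n$, bounding disjoint open convex sets $I_1,I_2$, let $\Omega$ be the associated space with its partial order $<$, let $F_1^2$ be the timelike Euclidean relative Funk distance of the ordered pair $(K_1,K_2)$, and let $\delta_1^2$ be the timelike intrinsic distance defined by the functional $f_{F_1^2}$. Then for every pair $(p,q)\in\Omega\times\Omega$ with $p\le q$, \[ F_1^2(p,q)=\delta_1^2(p,q). \]
   Context: $I_1,I_2\subset\mathbb{R}^n$ are nonempty open convex sets (possibly unbounded) with $I_1\cap I_2=\emptyset$, $K_i=\partial I_i$ and $K_1\cap K_2=\emptyset$. A supporting hyperplane of $K_i$ is a hyperplane $\pi$ with $\pi\cap K_i\neq\emptyset$ and such that $I_i$ is contained in one of the two components of $\mathbb{R}^n\setminus\pi$. $d$ is Euclidean distance. An open segment $]a_1,a_2[$ is called admissible if $a_1\in K_1$, $a_2\in K_2$, $]a_1,a_2[\cap(K_1\cup K_2)=\emptyset$, and $]a_1,a_2[$ is not contained in any supporting hyperplane of $K_1$ or of $K_2$. $\Omega$ is the union of all admissible segments. For distinct $p,q\in\Omega$, $p<q$ means that there is an admissible segment $]a_1,a_2[$ containing $p$ and $q$ with $a_1,p,q,a_2$ collinear in that order. $p\le q$ means $p<q$ or $p=q$. $\mathfrak{I}_2^+(p)=\{q\in\Omega: p<q\}$. Relative Funk distance: for $p<q$, $F_1^2(p,q)=\log\frac{d(p,b(p,q))}{d(q,b(p,q))}$, where $b(p,q)$ is the first intersection point with $K_2$ of the ray from $p$ through $q$;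 $F_1^2(p,p)=0$. Functional: let $K_1^2$ be the set of $k_2\in K_2$ such that there is $k_1\in K_1$ with $]k_1,k_2[\cap(K_1\cup K_2)=\emptyset$. Let $\widetilde{I_2}$ be the intersection, over all supporting hyperplanes $\pi$ of $K_2$ at points of $K_1^2$, of the open half-spaces bounded by $\pi$ and containing $I_2$, and let $\overline{\widetilde{K_2}}$ be the closure of $\widetilde{I_2}$. $C_2^+(p)\subset T_p\Omega=\mathbb{R}^n$ consists of $0$ and of the nonzero $v$ with $p+tv\in\mathfrak{I}_2^+(p)$ for some $t>0$. For nonzero $v\in C_2^+(p)$, $f_{F_1^2}(p,v)=\sup\{\tau>0: p+v/\tau\in\overline{\widetilde{K_2}}\}$; $f_{F_1^2}(p,0)=0$. Intrinsic distance: a piecewise $C^1$ curve $\sigma:[0,1]\to\Omega$ is timelike if $\sigma'(t)\in C_2^+(\sigma(t))$ for all $t$ (both one-sided derivatives at break points). $\mathrm{Length}(\sigma)=\int_0^1 f_{F_1^2}(\sigma(t),\sigma'(t))\,dt$, and $\delta_1^2(p,q)=\sup_\sigma\mathrm{Length}(\sigma)$ over timelike piecewise $C^1$ curves $\sigma:[0,1]\to\Omega$ with $\sigma(0)=p$, $\sigma(1)=q$. *)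

(* Defs.v *)
From HB Require Import structures.
From mathcomp Require Import all_boot all_order all_algebra.
From mathcomp Require Import all_classical all_reals all_analysis.

Set Implicit Arguments.
Unset Strict Implicit.
Unset Printing Implicit Defensive.

Import Order.TTheory GRing.Theory Num.Theory.
Import numFieldNormedType.Exports.

Local Open Scope classical_set_scope.
Local Open Scope ring_scope.

(* The norm that the library puts on ['rV[R]_n] is the sup norm.  It is used
   here only through its topology, which is the usual one; lengths are measured
   with the Euclidean distance [edist]. *)

Definition dotp (R : realType) (n : nat) (u v : 'rV[R]_n) : R :=
  (u *m v^T) 0 0.

Definition edist (R : realType) (n : nat) (x y : 'rV[R]_n) : R :=
  Num.sqrt (dotp (x - y) (x - y)).

Definition boundary (T : topologicalType) (A : set T) : set T :=
  closure A `\` interior A.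

Definition hyperplane (R : realType) (n : nat) (w : 'rV[R]_n) (c : R)
    : set 'rV[R]_n :=
  [set x | dotp w x = c].

Definition open_halfspace (R : realType) (n : nat) (w : 'rV[R]_n) (c : R)
    : set 'rV[R]_n :=
  [set x | c < dotp w x].

(* The components of the complement of [hyperplane w c] are
   [open_halfspace w c] and [open_halfspace (- w) (- c)].  As
   [hyperplane w c = hyperplane (- w) (- c)], every hyperplane with [I] on one
   of its sides is of the form [hyperplane w c] with [I] included in
   [open_halfspace w c]. *)
Definition supporting_hyperplane (R : realType) (n : nat) (I : set 'rV[R]_n)
    (w : 'rV[R]_n) (c : R) : Prop :=
  [/\ w != 0, hyperplane w c `&` boundary I !=set0 & I `<=` open_halfspace w c].

Definition open_segment (R : realType) (n : nat) (a b : 'rV[R]_n)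
    : set 'rV[R]_n :=
  [set x | exists t : R, 0 < t < 1 /\ x = a + t *: (b - a)].

Definition admissible (R : realType) (n : nat) (I1 I2 : set 'rV[R]_n)
    (a1 a2 : 'rV[R]_n) : Prop :=
  [/\ boundary I1 a1,
      boundary I2 a2,
      open_segment a1 a2 `&` (boundary I1 `|` boundary I2) = set0 &
      forall (w : 'rV[R]_n) (c : R),
        supporting_hyperplane I1 w c \/ supporting_hyperplane I2 w c ->
        ~ open_segment a1 a2 `<=` hyperplane w c].

Definition Omega (R : realType) (n : nat) (I1 I2 : set 'rV[R]_n)
    : set 'rV[R]_n :=
  [set x | exists a1 a2 : 'rV[R]_n,
    admissible I1 I2 a1 a2 /\ open_segment a1 a2 x].

Definition precedes (R : realType) (n : nat) (I1 I2 : set 'rV[R]_n)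
    (p q : 'rV[R]_n) : Prop :=
  p != q /\
  exists (a1 a2 : 'rV[R]_n) (s t : R),
    [/\ admissible I1 I2 a1 a2, 0 < s, s < t & t < 1] /\
    p = a1 + s *: (a2 - a1) /\ q = a1 + t *: (a2 - a1).

Definition precedes_eq (R : realType) (n : nat) (I1 I2 : set 'rV[R]_n)
    (p q : 'rV[R]_n) : Prop :=
  precedes I1 I2 p q \/ p = q.

Definition future (R : realType) (n : nat) (I1 I2 : set 'rV[R]_n)
    (p : 'rV[R]_n) : set 'rV[R]_n :=
  [set q | Omega I1 I2 q /\ precedes I1 I2 p q].

Definition is_first_hit (R : realType) (n : nat) (I2 : set 'rV[R]_n)
    (p q b : 'rV[R]_n) : Prop :=
  exists t : R,
    [/\ 0 <= t, b = p + t *: (q - p), boundary I2 b &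
        forall s : R, 0 <= s < t -> ~ boundary I2 (p + s *: (q - p))].

(* The default value [p] is taken when the ray misses the boundary of [I2];
   this does not happen when [p] precedes [q]. *)
Definition first_hit (R : realType) (n : nat) (I2 : set 'rV[R]_n)
    (p q : 'rV[R]_n) : 'rV[R]_n :=
  xget p [set b | is_first_hit I2 p q b].

Definition relative_Funk (R : realType) (n : nat) (I2 : set 'rV[R]_n)
    (p q : 'rV[R]_n) : R :=
  if p == q then 0
  else ln (edist p (first_hit I2 p q) / edist q (first_hit I2 p q)).

Definition visible_part (R : realType) (n : nat) (I1 I2 : set 'rV[R]_n)
    : set 'rV[R]_n :=
  [set k2 | boundary I2 k2 /\
    exists k1 : 'rV[R]_n, boundary I1 k1 /\
      open_segment k1 k2 `&` (boundary I1 `|` boundary I2) = set0].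

Definition extended_body (R : realType) (n : nat) (I1 I2 : set 'rV[R]_n)
    : set 'rV[R]_n :=
  [set x | forall (w : 'rV[R]_n) (c : R),
    supporting_hyperplane I2 w c ->
    hyperplane w c `&` visible_part I1 I2 !=set0 ->
    open_halfspace w c x].

Definition future_cone (R : realType) (n : nat) (I1 I2 : set 'rV[R]_n)
    (p : 'rV[R]_n) : set 'rV[R]_n :=
  [set v | v = 0 \/
    v != 0 /\ exists t : R, 0 < t /\ future I1 I2 p (p + t *: v)].

(* A real supremum: for [p] in [Omega] and nonzero [v] in [future_cone p] the
   set is nonempty and bounded, because the ray from [p] along [v] meets the
   closure of [extended_body] while [p] is outside this closure. *)
Definition Funk_functional (R : realType) (n : nat) (I1 I2 : set 'rV[R]_n)
    (p v : 'rV[R]_n) : R :=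
  if v == 0 then 0
  else sup [set tau : R |
         0 < tau /\ closure (extended_body I1 I2) (p + tau^-1 *: v)].

Definition has_right_derivative (R : realType) (n : nat)
    (sigma : R -> 'rV[R]_n) (t : R) (v : 'rV[R]_n) : Prop :=
  h^-1 *: (sigma (t + h) - sigma t) @[h --> 0^'+] --> v.

Definition has_left_derivative (R : realType) (n : nat)
    (sigma : R -> 'rV[R]_n) (t : R) (v : 'rV[R]_n) : Prop :=
  h^-1 *: (sigma (t + h) - sigma t) @[h --> 0^'-] --> v.

Definition C1_on (R : realType) (n : nat) (a b : R) (sigma : R -> 'rV[R]_n)
    : Prop :=
  exists dsigma : R -> 'rV[R]_n,
    [/\ {within `[a, b], continuous dsigma},
        forall t : R, a <= t < b -> has_right_derivative sigma t (dsigma t) &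
        forall t : R, a < t <= b -> has_left_derivative sigma t (dsigma t)].

Definition piecewise_C1 (R : realType) (n : nat) (sigma : R -> 'rV[R]_n)
    : Prop :=
  {within `[0, 1], continuous sigma} /\
  exists (m : nat) (x : nat -> R),
    [/\ x 0%N = 0, x m = 1 &
        forall i : nat, (i < m)%N ->
          x i < x i.+1 /\ C1_on (x i) (x i.+1) sigma].

(* A curve is a function on the whole of [R] of which only the restriction to
   [`[0, 1]] matters.  Where the derivative exists both one-sided derivatives
   are equal to it. *)
Definition timelike_curve (R : realType) (n : nat) (I1 I2 : set 'rV[R]_n)
    (sigma : R -> 'rV[R]_n) : Prop :=
  [/\ piecewise_C1 sigma,
      forall t : R, 0 <= t <= 1 -> Omega I1 I2 (sigma t),
      forall (t : R) (v : 'rV[R]_n), 0 <= t < 1 ->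
        has_right_derivative sigma t v -> future_cone I1 I2 (sigma t) v &
      forall (t : R) (v : 'rV[R]_n), 0 < t <= 1 ->
        has_left_derivative sigma t v -> future_cone I1 I2 (sigma t) v].

(* The derivative has no meaning at the break points and at 0 and 1, a finite
   set that does not contribute to the integral. *)
Definition curve_length (R : realType) (n : nat) (I1 I2 : set 'rV[R]_n)
    (sigma : R -> 'rV[R]_n) : \bar R :=
  (\int[lebesgue_measure]_(t in `[0%R, 1%R])
     (Funk_functional I1 I2 (sigma t) (derive1 sigma t))%:E)%E.

Definition intrinsic_distance (R : realType) (n : nat)
    (I1 I2 : set 'rV[R]_n) (p q : 'rV[R]_n) : \bar R :=
  ereal_sup [set curve_length I1 I2 sigma | sigma in
    [set sigma : R -> 'rV[R]_n |
      [/\ timelike_curve I1 I2 sigma, sigma 0 = p & sigma 1 = q]]].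

(* Main.v *)
Require Import Defs.
From HB Require Import structures.
From mathcomp Require Import all_boot all_order all_algebra.
From mathcomp Require Import all_classical all_reals all_analysis.
From mathcomp Require Import ring lra measurable_realfun.

Set Implicit Arguments.
Unset Strict Implicit.
Unset Printing Implicit Defensive.

Import Order.TTheory GRing.Theory Num.Theory.
Import numFieldNormedType.Exports.

Local Open Scope classical_set_scope.
Local Open Scope ring_scope.

(** Let [k2] be the end point on [K2] of an admissible segment through [p] and
    [q]. The line of the segment enters [I2] at [k2], for otherwise it would lie
    in a supporting hyperplane of [K2]. Hence every supporting hyperplane
    [w . x = c] of [K2] at [k2] is crossed transversally, and
    [F(p,q) = ln (g p / g q)] for [g x = c - w . x]. Where [g x > 0], future
    directions [v] at [x] satisfy [w . v >= 0], and the functional at [(x, v)]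
    is at most [w . v / g x]. So [g] does not increase along a timelike curve
    while it is positive; being positive at [q], it is positive on the whole
    curve, and the length is at most the integral of [- (ln g)'], that is
    [F(p,q)]. The straight segment has exactly this length. *)

(** * Euclidean inner product, continuity and bounded sets *)

Section Dotp.
Context {R : realType} {n : nat}.
Implicit Types u v w x y z : 'rV[R]_n.

Lemma dotpE u v : dotp u v = \sum_i u 0 i * v 0 i.
Proof. by rewrite /dotp mxE; apply: eq_bigr => i _; rewrite mxE. Qed.

Lemma dotpC u v : dotp u v = dotp v u.
Proof. by rewrite !dotpE; apply: eq_bigr => i _; rewrite mulrC. Qed.

Lemma dotpDr w u v : dotp w (u + v) = dotp w u + dotp w v.
Proof. by rewrite /dotp linearD mulmxDr mxE. Qed.

Lemma dotpZr w a u : dotp w (a *: u) = a * dotp w u.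
Proof. by rewrite /dotp linearZ -scalemxAr mxE. Qed.

Lemma dotpNr w u : dotp w (- u) = - dotp w u.
Proof. by rewrite -scaleN1r dotpZr mulN1r. Qed.

Lemma dotpBr w u v : dotp w (u - v) = dotp w u - dotp w v.
Proof. by rewrite dotpDr dotpNr. Qed.

Lemma dotpDl w u v : dotp (u + v) w = dotp u w + dotp v w.
Proof. by rewrite dotpC dotpDr 2!(dotpC w). Qed.

Lemma dotpZl w a u : dotp (a *: u) w = a * dotp u w.
Proof. by rewrite dotpC dotpZr dotpC. Qed.

Lemma dotpNl w u : dotp (- u) w = - dotp u w.
Proof. by rewrite dotpC dotpNr dotpC. Qed.

Lemma dotpBl w u v : dotp (u - v) w = dotp u w - dotp v w.
Proof. by rewrite dotpDl dotpNl. Qed.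

Lemma dotp0r w : dotp w 0 = 0.
Proof. by rewrite -(scale0r 0) dotpZr mul0r. Qed.

Definition dotp_linE := (dotpBr, dotpDr, dotpNr, dotpZr, dotpBl, dotpDl, dotpNl, dotpZl).

Lemma dotp_ge_coord u i : u 0 i ^+ 2 <= dotp u u.
Proof.
rewrite dotpE (bigD1 i)//= -expr2 lerDl sumr_ge0// => j _.
by rewrite -expr2 sqr_ge0.
Qed.

Lemma dotp_ge0 u : 0 <= dotp u u.
Proof. by rewrite dotpE sumr_ge0// => j _; rewrite -expr2 sqr_ge0. Qed.

Lemma dotp_gt0 u : u != 0 -> 0 < dotp u u.
Proof.
move=> u0; rewrite lt_neqAle dotp_ge0 andbT eq_sym; apply: contra u0 => /eqP uu.
apply/eqP/rowP => i; rewrite mxE; apply/eqP; rewrite -sqrf_eq0 eq_le sqr_ge0.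
by rewrite andbT -uu dotp_ge_coord.
Qed.

Lemma cvg_dotp {T : Type} {F : set_system T} {FF : Filter F} {f g : T -> 'rV[R]_n} {u v} :
  f @ F --> u -> g @ F --> v -> dotp (f x) (g x) @[x --> F] --> dotp u v.
Proof.
move=> fu gv; rewrite dotpE.
under eq_cvg do rewrite dotpE.
apply: (@cvg_big R _ +%R 0 xpredT) => [|i _]; first exact: add_continuous.
apply: cvgM.
- exact: (cvg_comp _ (fun M : 'rV[R]_n => M 0 i) fu (@coord_continuous _ _ _ _ _ _)).
- exact: (cvg_comp _ (fun M : 'rV[R]_n => M 0 i) gv (@coord_continuous _ _ _ _ _ _)).
Qed.

Lemma continuous_dotp w : continuous (dotp w).
Proof. by move=> x; apply: (@cvg_dotp _ (nbhs x) _ (fun=> w) id); [exact: cvg_cst|by []]. Qed.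

Lemma bounded_set_coord (A : set 'rV[R]_n) M :
  (forall x i, A x -> `|x 0 i| <= M) -> bounded_set A.
Proof.
move=> AM; exists `|M|; split; first exact: num_real.
move=> N MN x Ax; rewrite /Num.norm/= mx_normrE.
apply/bigmax_leP; split => [|[i j] _] /=; first exact: le_trans (ltW MN).
rewrite (ord1 i); apply: le_trans (ltW MN); exact: le_trans (AM _ _ Ax) (ler_norm _).
Qed.

Lemma bounded_set_dotp (A : set 'rV[R]_n) M :
  (forall x, A x -> dotp x x <= M) -> bounded_set A.
Proof.
(* A square at most [M] forces an absolute value at most [M + 1], which avoids square roots. *)
move=> AM; apply: (@bounded_set_coord _ (M + 1)) => x i /AM xM.
have := dotp_ge_coord x i; rewrite -real_normK ?num_real//.
have := normr_ge0 (x 0 i); set a := `|_|; rewrite !expr2 => *; nra.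
Qed.

End Dotp.

(** * Separation of a convex set from a point *)

Section Separation.
Context {R : realType} {n : nat}.
Implicit Types (u v w x y z : 'rV[R]_n) (J C : set 'rV[R]_n).

Definition is_convex J := forall x y (t : R),
  J x -> J y -> 0 <= t <= 1 -> J (x + t *: (y - x)).

(** The weight in [convex_set] has an interval type, so [t] is packed into it. It weighs the first
    of the two points, whence [x] and [y] are swapped. *)
Lemma convex_set_is_convex J :
  @convex_set R 'rV[R]_n J -> is_convex J.
Proof.
move=> cJ x y t Jx Jy /andP[t0 t1].
have ti : Itv.spec (@Itv.num_sem R) (Itv.Real `[0, 1]%Z) t.
  by rewrite /Itv.spec/= /Itv.num_sem/= num_real in_itv/= t0 t1.
have /set_mem := cJ y x (Itv.mk ti) (mem_set Jy) (mem_set Jx).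
congr J.
change (t *: y + (1 - t) *: x = x + t *: (y - x)).
by apply/rowP => i; rewrite !mxE; ring.
Qed.

Lemma cvg_subr x0 y : (y' - x0) @[y' --> y] --> y - x0.
Proof. exact: (cvgB (@cvg_id _ (nbhs y)) (cvg_cst x0)). Qed.

Lemma cvg_toward x z t : (z' + t *: (x - z')) @[z' --> z] --> z + t *: (x - z).
Proof.
have zz := @cvg_id _ (nbhs z).
exact: (cvgD zz (cvgZr (cvgB (cvg_cst x) zz))).
Qed.

(** Only points of [C] no farther from [x0] than a chosen [c0] compete, and they form a compact
    set. *)
Lemma nearest_point C x0 : closed C -> C !=set0 ->
  exists2 z, C z & forall y, C y -> dotp (z - x0) (z - x0) <= dotp (y - x0) (y - x0).
Proof.
move=> clC [c0 Cc0].
pose f y := dotp (y - x0) (y - x0).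
have cf : continuous f.
  by move=> y; exact: (cvg_dotp (@cvg_subr x0 y) (@cvg_subr x0 y)).
pose B := C `&` (f @^-1` [set r | r <= f c0]).
have clB : closed B.
  by apply: closedI => //; apply: closed_comp => // y _; exact: cf.
have bB : bounded_set B.
  (* The bound is [|y|^2 <= 2 |y - x0|^2 + 2 |x0|^2], equivalent to [0 <= |y - 2 x0|^2]. *)
  apply: (@bounded_set_dotp _ _ _ (2 * f c0 + 2 * dotp x0 x0)) => y [_ /= yc].
  have := dotp_ge0 (y - x0 - x0); move: yc.
  rewrite /f; set M := dotp (c0 - _) _.
  rewrite !dotp_linE (dotpC y x0); lra.
have [|z zB zmin] := EVT_min_rV _ (bounded_closed_compact bB clB) (continuous_subspaceT cf).
  by exists c0; split => //=.
move: zB; rewrite inE => -[Cz zc]; exists z => // y Cy.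
have [yc|/ltW cy] := leP (f y) (f c0); first by apply: zmin; rewrite inE.
exact: le_trans cy.
Qed.

(** The normal is [z - x0] for a nearest point [z] of the closure: if some [x] of [J] were on the
    wrong side, moving from [z] towards [x] would come closer to [x0]. *)
Lemma separation_closure J x0 : is_convex J -> J !=set0 -> ~ closure J x0 ->
  exists w, forall x, J x -> 0 < dotp w (x - x0).
Proof.
move=> cJ [j Jj] Nx0.
have [z Jz zmin] := @nearest_point (closure J) x0 (@closed_closure _ J)
  (ex_intro _ j (subset_closure Jj)).
exists (z - x0) => x Jx.
have z0 : 0 < dotp (z - x0) (z - x0).
  apply: dotp_gt0; rewrite subr_eq0; apply/eqP => zx; apply: Nx0; by rewrite -zx.
have seg t : 0 <= t <= 1 -> closure J (z + t *: (x - z)).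
  move=> t01 U.
  have ct : (y + t *: (x - y)) @[y --> z] --> z + t *: (x - z).
    exact: cvg_toward.
  move=> /ct /= Uz; have [y [Jy Uy]] := Jz _ Uz.
  by exists (y + t *: (x - y)); split => //; exact: cJ.
rewrite ltNge; apply/negP => le0.
set a := z - x0 in z0 le0; set b := x - z.
have xE : x - x0 = b + a by rewrite /a /b addrA subrK.
have min t : 0 <= t <= 1 -> dotp a a <= dotp (a + t *: b) (a + t *: b).
  by move=> /seg /zmin; rewrite [z + _ - x0]addrAC.
rewrite {}xE in le0; clearbody a b.
have ab : dotp a b < 0 by move: le0; rewrite dotpDr; lra.
have key t : 0 <= t <= 1 -> 0 <= t * (2 * dotp a b + t * dotp b b).
  by move=> /min; rewrite dotpDr !dotpDl !dotpZr !dotpZl (dotpC b a) => h; lra.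
have bb := dotp_ge0 b.
(* With this [t], [2 a.b + t b.b] equals [(1 + t) a.b < 0], against [key]. *)
pose t := - dotp a b / (dotp b b - dotp a b).
have t01 : 0 <= t <= 1.
  rewrite /t divr_ge0 ?ler_pdivrMr; try lra.
have tp : 0 < t by rewrite /t divr_gt0; lra.
have := key _ t01; rewrite pmulr_rge0//.
have : t * (dotp b b - dotp a b) = - dotp a b by rewrite /t divfK// gt_eqF//; lra.
nra.
Qed.

(** The map [phi] fixes [x0] and sends [z] to [y]. A point [z'] of [J] near [z] has its image in [J]
    by openness, and [x0] lies between [z'] and [phi z']. *)
Lemma convex_open_between J x0 y z t : is_convex J -> open J -> J y -> closure J z ->
  0 < t <= 1 -> x0 = z + t *: (y - z) -> J x0.
Proof.
move=> cJ oJ Jy Jz /andP[t0 t1] x0E.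
pose phi z' := z' + t^-1 *: (x0 - z').
have phiz : phi z = y.
  by apply/rowP => i; rewrite /phi x0E !mxE; field; rewrite gt_eqF.
have cphi : phi z' @[z' --> z] --> phi z.
  exact: cvg_toward.
have /cphi/= Nz : nbhs (phi z) J by rewrite phiz; exact: open_nbhs_nbhs.
have [z' [Jz' Jphi]] := Jz _ Nz.
have -> : x0 = z' + t *: (phi z' - z').
  by apply/rowP => i; rewrite /phi !mxE; field; rewrite gt_eqF.
by apply: cJ => //; rewrite ltW.
Qed.

Lemma nbhs_line U x u : nbhs x U ->
  exists2 d : R, 0 < d & forall s, `|s| <= d -> U (x + s *: u).
Proof.
move=> xU.
have cl : (x + s *: u) @[s --> (0 : R)] --> x + 0 *: u.
  exact: (cvgD (cvg_cst x) (cvgZl (@cvg_id _ (nbhs (0 : R))))).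
have /cl/= /nbhs_ballP[e /= e0 eU] : nbhs (x + 0 *: u) U.
  by rewrite scale0r addr0.
exists (e / 2) => [|s se]; first by rewrite divr_gt0.
by apply: eU; rewrite /ball/= sub0r normrN; lra.
Qed.

(* The point [z] just beyond [x0] on the ray from [y] is outside [closure J],
   so that a nearest point of [closure J] to [z] gives a strict separation. *)
Lemma approx_separation J y x0 e : is_convex J -> open J -> J y -> ~ J x0 -> 0 < e ->
  exists w, dotp w (y - x0) = 1 /\ forall x, J x -> - e <= dotp w (x - x0).
Proof.
move=> cJ oJ Jy Nx0 e0.
pose z := x0 + e *: (x0 - y).
have Nz : ~ closure J z.
  move=> Jz; apply: Nx0.
  apply: (@convex_open_between J x0 y z (e / (1 + e)) cJ oJ Jy Jz).
    by rewrite divr_gt0 ?ler_pdivrMr; lra.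
  by apply/rowP => i; rewrite !mxE; field; lra.
have [w wJ] := separation_closure cJ (ex_intro _ y Jy) Nz.
have wE x : dotp w (x - z) = dotp w (x - x0) + e * dotp w (y - x0).
  by rewrite /z !dotp_linE; ring.
have w0 : 0 < dotp w (y - x0) by have := wJ _ Jy; rewrite wE; nra.
exists ((dotp w (y - x0))^-1 *: w); split.
  by rewrite dotpZl mulVf// gt_eqF.
move=> x /wJ; rewrite wE dotpZl ler_pdivlMl//; lra.
Qed.

(* The normalization [w . (y - x0) = 1] keeps the approximate separators in a
   compact set, because [y] is interior to [J]. *)
Lemma separation J x0 : is_convex J -> open J -> J !=set0 -> ~ J x0 ->
  exists w, w != 0 /\ forall x, J x -> 0 < dotp w (x - x0).
Proof.
move=> cJ oJ [y Jy] Nx0.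
pose A e := [set w | dotp w (y - x0) = 1 /\ forall x, J x -> - e <= dotp w (x - x0)].
have clge u a : closed [set w | a <= dotp w u].
  have -> : [set w | a <= dotp w u] = dotp u @^-1` [set r | a <= r].
    by apply/seteqP; split => w /=; rewrite dotpC.
  by apply: closed_comp => [w _|]; [exact: continuous_dotp|exact: closed_ge].
have clA : closed (A 1).
  (* The normalizing equation is split into two inequalities, so that only closed half-spaces are
     intersected. *)
  have -> : A 1 = [set w | 1 <= dotp w (y - x0)] `&`
      [set w | -1 <= dotp w (x0 - y)] `&`
      \bigcap_(x in J) [set w | -1 <= dotp w (x - x0)].
    apply/seteqP; split => [w /= [wy wJ]|w /= [[w1 w2] wJ]].
      by split => //; split; [rewrite wy|rewrite -opprB dotpNr wy].
    split => //; apply/eqP; rewrite eq_le w1 andbT.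
    by move: w2; rewrite -opprB dotpNr lerN2.
  apply: closedI; first exact: closedI.
  by apply: closed_bigI => x _; exact: clge.
have [r /= r0 rJ] : exists2 r : R, 0 < r & ball y r `<=` J.
  by apply/nbhs_ballP; exact: open_nbhs_nbhs.
have bA : bounded_set (A 1).
  apply: (@bounded_set_coord _ _ _ (4 / r)) => w i [w1 wJ].
  (* Testing [w] on the points of [J] at [r / 2] from [y] along both senses of an axis bounds each
     coordinate. *)
  have Jd s : `|s| = r / 2 -> J (y + s *: delta_mx 0 i).
    move=> sr; apply: rJ; split => // j k; rewrite !mxE /ball/= opprD addNKr normrN normrM sr.
    by rewrite ger0_norm ?ler0n//; case: (_ && _); rewrite /= ?mulr1 ?mulr0; lra.
  have dE : dotp w (delta_mx 0 i) = w 0 i.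
    rewrite dotpE (bigD1 i)//= mxE !eqxx mulr1 big1 ?addr0// => j ji.
    by rewrite mxE (negbTE ji) andbF mulr0.
  have step s : `|s| = r / 2 -> - 2 <= s * w 0 i.
    by move=> /Jd /wJ; rewrite addrAC dotpDr w1 dotpZr dE; lra.
  have := step (r / 2); have := step (- (r / 2)).
  rewrite normrN ger0_norm ?divr_ge0 ?(ltW r0)// => /(_ erefl) h1 /(_ erefl) h2.
  by rewrite ler_norml ler_pdivlMr// -mulNr ler_pdivrMr//; apply/andP; split; lra.
have cA : compact (A 1) by exact: bounded_closed_compact.
have /choice[w_ wP] : forall k : nat, exists w, A k.+1%:R^-1 w.
  by move=> k; apply: approx_separation => //; rewrite invr_gt0.
have F1 : (w_ @ \oo) (A 1).
  exists 0%N => // k _; have [wk1 wkJ] := wP k; split => // x /wkJ; apply: le_trans.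
  by rewrite lerN2 invf_le1 ?ler1n.
have [w [[wy _] wcl]] := cA _ _ F1.
have w_ge0 x : J x -> 0 <= dotp w (x - x0).
  move=> Jx; rewrite leNgt; apply/negP => wx.
  have [N] : exists N : nat, 0 + N.+1%:R^-1 < - dotp w (x - x0).
    by apply: ltr_add_invr; lra.
  rewrite add0r => Nd.
  (* A closed half-space containing a tail of the sequence contains its cluster point. *)
  pose E := [set w' | - N.+1%:R^-1 <= dotp w' (x - x0)].
  have FE : (w_ @ \oo) E.
    exists N => // k /= Nk; have [_ /(_ _ Jx)] := wP k; apply: le_trans.
    by rewrite lerN2 lef_pV2 ?posrE ?ler_nat.
  move: wcl; rewrite clusterE => /(_ _ FE); rewrite -(closure_id E).1; last exact: clge.
  by rewrite /E/= leNgt ltrNr Nd.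
have w0 : w != 0.
  by apply/eqP => w0; move: wy; rewrite w0 dotpC dotp0r => /eqP; rewrite eq_sym oner_eq0.
exists w; split => // x Jx.
(* Strictness: [J] is open, so it also contains a point [x - d w], where the product is smaller by
   [d w.w > 0] and still nonnegative. *)
have [d d0 dJ] := nbhs_line w (open_nbhs_nbhs (conj oJ Jx)).
have := w_ge0 _ (dJ (- d) _); rewrite normrN gtr0_norm// lexx => /(_ isT).
by rewrite !dotp_linE; have := dotp_gt0 w0; nra.
Qed.

End Separation.

(** * Boundary points and cylinders over open sets *)

Section Boundary.
Context {R : realType} {n : nat}.
Implicit Types (x y a b : 'rV[R]_n) (I J : set 'rV[R]_n).

Lemma open_boundary I x : open I -> boundary I x -> closure I x /\ ~ I x.
Proof. by move=> oI [clx]; rewrite (interior_id I).1. Qed.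

Lemma closure_disjoint I J x : open J -> I `&` J = set0 -> closure I x -> ~ J x.
Proof.
move=> oJ IJ clx Jx; have [y yIJ] := clx _ (open_nbhs_nbhs (conj oJ Jx)).
by move: yIJ; rewrite IJ.
Qed.

Lemma closure_halfspace I w c x :
  I `<=` open_halfspace w c -> closure I x -> c <= dotp w x.
Proof.
move=> Ic clx.
have clc : closed (dotp w @^-1` [set r | c <= r]).
  by apply: closed_comp => [y _|]; [exact: continuous_dotp|exact: closed_ge].
have : closure (dotp w @^-1` [set r | c <= r]) x.
  by apply: closure_subset clx => y /Ic /ltW.
by rewrite -(closure_id _).1.
Qed.

(** The boundary point is the last point of the segment outside [I]: it is not in [I] because [I] is
    open, and the points just after it are in [I]. *)
Lemma boundary_on_segment I x y : open I -> ~ I x -> I y ->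
  exists2 u : R, 0 <= u < 1 & boundary I (x + u *: (y - x)).
Proof.
move=> oI Nx Iy.
pose S := [set u : R | 0 <= u <= 1 /\ ~ I (x + u *: (y - x))].
have S0 : S 0 by split; rewrite ?lexx ?ler01// scale0r addr0.
have hS : has_sup S.
  by split; [exists 0|exists 1 => u [/andP[_ u1] _]].
have Sub u : S u -> u <= sup S by move=> Su; apply: ub_le_sup => //; case: hS.
set b := sup S in Sub.
have b0 : 0 <= b := Sub _ S0.
have step r s : x + (r + s) *: (y - x) = x + r *: (y - x) + s *: (y - x).
  by rewrite scalerDl addrA.
have NIb : ~ I (x + b *: (y - x)).
  move=> Ib; have [d d0 dI] := nbhs_line (y - x) (open_nbhs_nbhs (conj oI Ib)).
  have : b <= b - d.
    apply: ge_sup; [by exists 0|move=> u Su].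
    rewrite leNgt; apply/negP => bu; case: (Su) => _; apply.
    have -> : u = b + (u - b) by rewrite addrC subrK.
    by rewrite step; apply: dI; have := Sub _ Su; rewrite ler_norml; lra.
  by lra.
have b1 : b < 1.
  rewrite lt_neqAle ge_sup ?andbT; last 2 first.
  - by case: hS.
  - by move=> u [/andP[]].
  by apply/eqP => b1; apply: NIb; rewrite b1 scale1r addrC subrK.
exists b; first by rewrite b0.
split; last by move=> /interior_subset.
move=> U /(nbhs_line (y - x))[d d0 dU].
(* The step stays in the neighbourhood and does not pass [y]; beyond the supremum of [S] it must
   land in [I]. *)
pose e := Num.min d (1 - b).
have e0 : 0 < e by rewrite lt_min d0 subr_gt0.
have ed : e <= d by rewrite ge_min lexx.
have e1 : e <= 1 - b by rewrite ge_min lexx orbT.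
exists (x + b *: (y - x) + e *: (y - x)); split; last by apply: dU; rewrite gtr0_norm.
rewrite -step; apply: contrapT => NI.
suff /Sub : S (b + e) by lra.
by split => //; apply/andP; split; lra.
Qed.

(** The set is the cylinder over [I] with direction [d], a union of translates of [I]. Separating a
    point from it controls a whole line at once. *)
Lemma open_translates I d : open I -> open [set x | exists r : R, I (x + r *: d)].
Proof.
move=> oI; have -> : [set x | exists r : R, I (x + r *: d)] =
    \bigcup_(r in [set: R]) ((fun x => x + r *: d) @^-1` I).
  by apply/seteqP; split => x [r]; exists r.
apply: bigcup_open => r _; apply: open_comp => // x _.
exact: (cvgD (@cvg_id _ (nbhs x)) (cvg_cst (r *: d))).
Qed.

Lemma convex_translates I d : is_convex I ->
  is_convex [set x | exists r : R, I (x + r *: d)].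
Proof.
move=> cI x y t [r Ix] [s Iy] t01; exists (r + t * (s - r)).
have := cI _ _ _ Ix Iy t01; congr I; apply/rowP => i; rewrite !mxE; ring.
Qed.

End Boundary.

(** * Admissible segments, supporting hyperplanes and the functional *)

Section Support.
Context {R : realType} {n : nat} {I1 I2 : set 'rV[R]_n}.
Hypothesis I1_open : open I1.
Hypothesis I2_open : open I2.
Hypothesis I2_neq0 : I2 !=set0.
Hypothesis I2_convex : is_convex I2.
Hypothesis I12_disjoint : I1 `&` I2 = set0.
Hypothesis K12_disjoint : boundary I1 `&` boundary I2 = set0.
Implicit Types (a p q x v w : 'rV[R]_n) (c : R).

(* Otherwise the line would be separated from [I2] by a supporting hyperplane
   containing it. *)
Lemma admissible_line_meets a1 a2 : admissible I1 I2 a1 a2 ->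
  exists s : R, I2 (a2 + s *: (a2 - a1)).
Proof.
move=> [_ K2a2 _ Nsupp]; apply: contrapT => NI.
have [z Iz] := I2_neq0.
have [_ _] := open_boundary I2_open K2a2.
pose J := [set x | exists r : R, I2 (x + r *: (a2 - a1))].
have cJ : is_convex J by exact: convex_translates.
have Jz : J z by exists 0; rewrite scale0r addr0.
have [w [w0 wP]] := separation cJ (open_translates I2_open) (ex_intro _ z Jz) NI.
have {}wP x r : I2 x -> 0 < dotp w (x - a2) + r * dotp w (a2 - a1).
  move=> Ix; have Jx : J (x + r *: (a2 - a1)).
    by exists (- r); rewrite scaleNr addrK.
  by have := wP _ Jx; rewrite !dotp_linE; lra.
(* An affine function of [r] that is positive for all real [r] has slope zero. *)
have wd : dotp w (a2 - a1) = 0.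
  apply: contrapT => /eqP d0.
  have := wP z (- dotp w (z - a2) / dotp w (a2 - a1)) Iz.
  by rewrite divfK// subrr ltxx.
apply: (Nsupp w (dotp w a2)).
  right; split => //; first by exists a2.
  by move=> x /(wP _ 0); rewrite mul0r addr0 dotpBr subr_gt0.
move=> _ [t [_ ->]]; rewrite /hyperplane/= dotpDr dotpZr wd mulr0 addr0.
by apply/esym/eqP; rewrite -subr_eq0 -dotpBr wd.
Qed.

(** The line meets [I2] at some parameter [s], and [s <= 0] is impossible. For [s <= -1], convexity
    puts [a1] into [I2]. For [-1 < s <= 0], the line meets [K2] at [a1] or inside the open
    segment. *)
Lemma admissible_line_enters a1 a2 : admissible I1 I2 a1 a2 ->
  exists2 s : R, 0 < s & I2 (a2 + s *: (a2 - a1)).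
Proof.
move=> adm; have [s Is] := admissible_line_meets adm.
exists s => //; case: adm => K1a1 K2a2 seg0 _.
have [cla1 _] := open_boundary I1_open K1a1.
have [cla2 Na2] := open_boundary I2_open K2a2.
have Na1 : ~ I2 a1 by exact: closure_disjoint cla1.
rewrite ltNge; apply/negP => s0.
have [s1|s1] := leP s (- 1).
  apply: Na1; apply: (convex_open_between (t := - s^-1) I2_convex I2_open Is cla2).
    rewrite oppr_gt0 invr_lt0; apply/andP; split; first by lra.
    by rewrite -invrN invf_le1; lra.
  rewrite addrAC subrr add0r scalerA mulNr mulVf ?scaleN1r ?opprB ?[a2 + _]addrC ?subrK//.
  by rewrite ltr0_neq0//; lra.
have [u /andP[u0 u1] Ku] := boundary_on_segment I2_open Na1 Is.
have bE : a1 + u *: (a2 + s *: (a2 - a1) - a1) = a1 + (u * (1 + s)) *: (a2 - a1).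
  by apply/rowP => i; rewrite !mxE; ring.
rewrite bE in Ku.
have [uE|uN] := eqVneq u 0.
  have : (boundary I1 `&` boundary I2) a1.
    by split=> //; move: Ku; rewrite uE mul0r scale0r addr0.
  by rewrite K12_disjoint.
suff : (open_segment a1 a2 `&` (boundary I1 `|` boundary I2))
    (a1 + (u * (1 + s)) *: (a2 - a1)) by rewrite seg0.
split; last by right.
exists (u * (1 + s)); split => //.
have u0' : 0 < u by rewrite lt_neqAle eq_sym uN.
by apply/andP; split; nra.
Qed.

(** A supporting hyperplane at [a2] works: it is transversal to the segment because the prolonged
    segment enters [I2], and [a1] makes [a2] visible. *)
Lemma admissible_support a1 a2 : admissible I1 I2 a1 a2 ->
  exists w c, [/\ supporting_hyperplane I2 w c,
    hyperplane w c `&` visible_part I1 I2 !=set0,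
    dotp w a2 = c & 0 < dotp w (a2 - a1)].
Proof.
move=> adm; have [s s0 Is] := admissible_line_enters adm.
case: adm => K1a1 K2a2 seg0 _.
have [cla2 Na2] := open_boundary I2_open K2a2.
have [w [w0 wP]] := separation I2_convex I2_open I2_neq0 Na2.
exists w, (dotp w a2); split => //.
- split => //; first by exists a2.
  by move=> x /wP; rewrite dotpBr subr_gt0.
- by exists a2; split => //; split => //; exists a1.
- by have := wP _ Is; rewrite addrAC subrr add0r dotpZr pmulr_rgt0.
Qed.

(** A nonzero [v] is a positive multiple of the direction of an admissible segment through [p],
    whose end point in [K2] satisfies [w . a2 >= c > w . p]. *)
Lemma future_cone_support p v w c : supporting_hyperplane I2 w c ->
  dotp w p < c -> future_cone I1 I2 p v -> 0 <= dotp w v.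
Proof.
move=> [_ _ I2c] pc [->|[_ [t [t0 [_ [_ [a1 [a2 [s [s' pq]]]]]]]]]].
  by rewrite dotp0r.
have [[adm s0 ss' s'1] [pE qE]] := pq.
have [_ K2a2 _ _] := adm.
have [cla2 _] := open_boundary I2_open K2a2.
have := closure_halfspace I2c cla2.
have : t * dotp w v = (s' - s) * dotp w (a2 - a1).
  rewrite -!dotpZr; congr dotp; apply: (addrI p); rewrite qE pE.
  by apply/rowP => i; rewrite !mxE; ring.
move: pc; rewrite pE dotpDr dotpZr dotpBr.
set x := dotp w a2; set y := dotp w a1; set z := dotp w v => h1 h2 h3.
have xy : 0 < x - y by nra.
have : 0 < t * z by rewrite h2 mulr_gt0// subr_gt0.
by rewrite pmulr_rgt0// => /ltW.
Qed.

Lemma Funk_functional_ge0 p v : 0 <= Funk_functional I1 I2 p v.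
Proof.
rewrite /Funk_functional; case: ifPn => // _; set S := [set _ | _].
(* Without a real supremum, [sup] has the default value 0. *)
have [hS|/sup_out->//] := pselect (has_sup S).
case: hS (hS) => -[t St] _ hS; apply: (@le_trans _ _ t); first by case: St => /ltW.
by apply: ub_le_sup => //; case: hS.
Qed.

(** The extended body lies in the half-space of this hyperplane, so its closure is reached from [p]
    along [v] no earlier than the hyperplane is. *)
Lemma Funk_set_ubound p v w c : supporting_hyperplane I2 w c ->
  hyperplane w c `&` visible_part I1 I2 !=set0 -> dotp w p < c ->
  ubound [set tau : R | 0 < tau /\ closure (extended_body I1 I2) (p + tau^-1 *: v)]
    (dotp w v / (c - dotp w p)).
Proof.
move=> supp vis pc tau [tau0 cl].
have : c <= dotp w (p + tau^-1 *: v).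
  by apply: closure_halfspace cl => x; exact.
rewrite dotpDr dotpZr ler_pdivlMr ?subr_gt0// -lerBlDl -ler_pdivrMl ?invr_gt0//.
by rewrite invrK.
Qed.

Lemma Funk_functional_le p v w c : supporting_hyperplane I2 w c ->
  hyperplane w c `&` visible_part I1 I2 !=set0 -> dotp w p < c -> 0 <= dotp w v ->
  Funk_functional I1 I2 p v <= dotp w v / (c - dotp w p).
Proof.
move=> supp vis pc v0.
have ge0 : 0 <= dotp w v / (c - dotp w p) by rewrite divr_ge0// subr_ge0 ltW.
rewrite /Funk_functional; case: ifPn => // _; set S := [set _ | _].
(* The empty set has [sup] equal to 0, and here the sign of [dotp w v] is used. *)
have [->|S0] := eqVneq S set0; first by rewrite sup0.
by apply: ge_sup; [exact/set0P|exact: Funk_set_ubound].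
Qed.

(** The bound given by a supporting hyperplane at [a2] is attained, because the ray reaches the
    closure of the extended body at [a2]. *)
Lemma Funk_functional_admissible a1 a2 (s r : R) : admissible I1 I2 a1 a2 ->
  s < 1 -> 0 <= r ->
  Funk_functional I1 I2 (a1 + s *: (a2 - a1)) (r *: (a2 - a1)) = r / (1 - s).
Proof.
move=> adm s1; rewrite le_eqVlt => /orP[/eqP<-|r0].
  by rewrite scale0r /Funk_functional eqxx mul0r.
have [w [c [supp vis wc wd]]] := admissible_support adm.
set p := a1 + _; set v := r *: _.
have pc : c - dotp w p = (1 - s) * dotp w (a2 - a1).
  by rewrite -wc /p !dotp_linE; ring.
have wv : dotp w v / (c - dotp w p) = r / (1 - s).
  by rewrite pc /v dotpZr -mulf_div divff ?mulr1// gt_eqF.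
have pc0 : dotp w p < c by rewrite -subr_gt0 pc mulr_gt0//; lra.
have v0 : v != 0.
  by apply: contraTneq wd => v0; have := congr1 (dotp w) v0;
     rewrite dotpZr dotp0r => /eqP; rewrite mulf_eq0 gt_eqF//= => /eqP->; rewrite ltxx.
apply/eqP; rewrite eq_le; apply/andP; split.
  rewrite -wv; apply: Funk_functional_le => //.
  by rewrite /v dotpZr mulr_ge0// ltW.
rewrite /Funk_functional (negbTE v0); apply: ub_le_sup.
  by exists (dotp w v / (c - dotp w p)); exact: Funk_set_ubound.
split; first by rewrite divr_gt0//; lra.
have -> : p + (r / (1 - s))^-1 *: v = a2.
  rewrite /v scalerA invf_div divfK ?gt_eqF// /p -addrA -scalerDl [s + _]addrC subrK.
  by rewrite scale1r addrC subrK.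
case: adm => _ K2a2 _ _; have [cla2 _] := open_boundary I2_open K2a2.
by apply: closure_subset cla2 => x Ix w' c' [_ _ I2c'] _; exact: I2c'.
Qed.

Lemma first_hit_admissible a1 a2 (s t : R) : admissible I1 I2 a1 a2 ->
  0 < s -> s < t -> t < 1 ->
  first_hit I2 (a1 + s *: (a2 - a1)) (a1 + t *: (a2 - a1)) = a2.
Proof.
move=> [_ K2a2 seg0 _] s0 st t1; set p := a1 + _; set q := a1 + _.
have pqE r : p + r *: (q - p) = a1 + (s + r * (t - s)) *: (a2 - a1).
  by apply/rowP => i; rewrite /p /q !mxE; ring.
(* The parameter of [a2] on the ray from [p] through [q]; smaller nonnegative parameters give points
   of the open segment. *)
pose T := (1 - s) / (t - s).
have a2E : a2 = p + T *: (q - p).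
  rewrite pqE /T divfK ?subr_eq0 ?gt_eqF//.
  by apply/rowP => i; rewrite !mxE; ring.
have Nb r : 0 <= r < T -> ~ boundary I2 (p + r *: (q - p)).
  move=> /andP[r0]; rewrite /T ltr_pdivlMr ?subr_gt0// => rT Kr.
  suff : (open_segment a1 a2 `&` (boundary I1 `|` boundary I2)) (p + r *: (q - p)).
    by rewrite seg0.
  split; last by right.
  by exists (s + r * (t - s)); split; [apply/andP; split; nra|].
have T0 : 0 <= T by rewrite divr_ge0// subr_ge0 ltW// (lt_trans st).
apply: xget_unique => [|b [T' [T'0 -> KT' NT']]]; first by exists T; split; rewrite -?a2E.
suff -> : T' = T by [].
apply/eqP; rewrite eq_le !leNgt; apply/andP; split; apply/negP => h.
- apply: (NT' T); first by rewrite T0.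
  by move: K2a2; rewrite {1}a2E.
- by apply: (Nb T'); rewrite ?T'0.
Qed.

Lemma edistZ x v (r s : R) : r <= s ->
  Defs.edist (x + r *: v) (x + s *: v) = (s - r) * Num.sqrt (dotp v v).
Proof.
move=> rs; rewrite /Defs.edist.
have -> : x + r *: v - (x + s *: v) = (r - s) *: v.
  by apply/rowP => i; rewrite !mxE; ring.
rewrite dotpZl dotpZr mulrA -expr2 sqrtrM ?sqr_ge0// sqrtr_sqr distrC ger0_norm//.
by rewrite subr_ge0.
Qed.

Lemma admissible_neq a1 a2 : admissible I1 I2 a1 a2 -> a1 != a2.
Proof.
move=> [K1a1 K2a2 _ _]; apply/eqP => a12.
have : (boundary I1 `&` boundary I2) a1 by split => //; rewrite a12.
by rewrite K12_disjoint.
Qed.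

Lemma relative_Funk_admissible a1 a2 (s t : R) : admissible I1 I2 a1 a2 ->
  0 < s -> s <= t -> t < 1 ->
  relative_Funk I2 (a1 + s *: (a2 - a1)) (a1 + t *: (a2 - a1)) = ln ((1 - s) / (1 - t)).
Proof.
move=> adm s0 + t1; have a12 := admissible_neq adm.
rewrite le_eqVlt => /orP[/eqP->|st].
  by rewrite /relative_Funk eqxx divff ?ln1// subr_eq0 gt_eqF.
have d0 : a2 - a1 != 0 by rewrite subr_eq0 eq_sym.
rewrite /relative_Funk (first_hit_admissible adm)// ifN; last first.
  apply/eqP => /addrI /eqP; rewrite -subr_eq0 -scalerBl scaler_eq0 (negbTE d0) orbF.
  by rewrite subr_eq0 lt_eqF.
have dist (r : R) : r <= 1 ->
    Defs.edist (a1 + r *: (a2 - a1)) a2 = (1 - r) * Num.sqrt (dotp (a2 - a1) (a2 - a1)).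
  by move=> r1; rewrite -(edistZ a1)// scale1r [a1 + (a2 - a1)]addrC subrK.
rewrite !dist ?(ltW t1) ?(ltW (lt_trans st t1))//.
congr ln; have : 0 < Num.sqrt (dotp (a2 - a1) (a2 - a1)) by rewrite sqrtr_gt0 dotp_gt0.
by move=> e0; rewrite -mulf_div divff ?mulr1// gt_eqF.
Qed.

End Support.

(** * Lower integrals, monotonicity and logarithmic derivatives *)

Section Calculus.
Context {R : realType}.
Implicit Types (f g dg : R -> R) (a b t : R).
Notation mu := (@lebesgue_measure R).

(* No measurability is needed, because the integral of a nonnegative function
   is the supremum of the integrals of the simple functions below it. *)
Lemma ge0_le_lower_integral (D : set R) (f g : R -> \bar R) :
  (forall t, D t -> (0 <= f t)%E) -> (forall t, D t -> (f t <= g t)%E) ->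
  (\int[mu]_(t in D) f t <= \int[mu]_(t in D) g t)%E.
Proof.
move=> f0 fg; have g0 t : D t -> (0 <= g t)%E.
  by move=> Dt; exact: le_trans (f0 _ Dt) (fg _ Dt).
rewrite ge0_integralE// [leRHS]ge0_integralE//.
apply: le_ereal_sup => _ [h /= hf <-]; exists h => //= t.
apply: le_trans (hf t) _; rewrite /patch; case: ifPn => // /set_mem Dt.
exact: fg.
Qed.

(* After the last zero of [g] before [b], [g] would be nonincreasing. *)
Lemma gt0_backwards g dg a b : a < b -> {within `[a, b], continuous g} ->
  (forall t, a < t < b -> is_derive t 1 g (dg t)) -> 0 < g b ->
  (forall t, a < t < b -> 0 < g t -> dg t <= 0) ->
  forall t, a <= t <= b -> 0 < g t.
Proof.
move=> ab cg dgP gb dg_le0 t1 /andP[at1 t1b].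
rewrite ltNge; apply/negP => gt1.
pose S := [set t | t1 <= t <= b /\ g t <= 0].
have S1 : S t1 by rewrite /S/= lexx.
have SE : S = (g @^-1` [set r | r <= 0]) `&` `[t1, b].
  by apply/seteqP; split => u /=; rewrite in_itv/= => -[].
have cg1 : {within `[t1, b], continuous g}.
  apply: continuous_subspaceW cg => u /=; rewrite !in_itv/= => /andP[t1u ->].
  by rewrite (le_trans at1).
have clS : closed S.
  rewrite SE closed_setIS; last exact: interval_closed.
  by move/continuous_closedP : cg1; apply; exact: closed_le.
have cS : compact S.
  apply: (subclosed_compact clS (@segment_compact _ t1 b)).
  by rewrite SE; exact: subIsetr.
have [t0 /set_mem[/andP[t10 t0b] gt0] t0max] := @compact_EVT_max _ _ id S
  (ex_intro _ _ S1) cS (continuous_subspaceT (fun x => @cvg_id _ (nbhs x))).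
have gpos t : t0 < t -> t <= b -> 0 < g t.
  move=> t0t tb; rewrite ltNge; apply/negP => gt.
  have /mem_set/t0max : S t by split => //; rewrite tb andbT (le_trans t10)// ltW.
  by rewrite leNgt t0t.
have {}t0b : t0 < b.
  by rewrite lt_neqAle t0b andbT; apply: contraTneq gb => <-; rewrite -leNgt.
have cg0 : {within `[t0, b], continuous g}.
  apply: continuous_subspaceW cg => u /=; rewrite !in_itv/= => /andP[t0u ->].
  by rewrite (le_trans at1)// (le_trans t10).
have dg0 u : u \in `]t0, b[ -> is_derive u 1 g (dg u).
  rewrite in_itv/= => /andP[t0u ub]; apply: dgP.
  by rewrite ub andbT (le_lt_trans at1)// (le_lt_trans t10).
(* The mean value theorem yields [g b <= g t0 <= 0], a contradiction. *)
have [u] := MVT t0b dg0 cg0; rewrite in_itv/= => /andP[t0u ub] eq.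
have dgu : dg u <= 0.
  apply: dg_le0; last by apply: gpos => //; exact: ltW.
  by rewrite ub andbT (le_lt_trans at1)// (le_lt_trans t10).
have : dg u * (b - t0) <= 0 by rewrite mulr_le0_ge0// subr_ge0 ltW.
by rewrite -eq subr_le0 leNgt (le_lt_trans gt0).
Qed.

(** The fundamental theorem of calculus for [- ln g]. Measurability is recorded because this
    integrand later serves as a majorant. *)
Lemma integral_logarithmic_derivative g dg a b : a < b ->
  {within `[a, b], continuous g} -> {within `[a, b], continuous dg} ->
  (forall t, a < t < b -> is_derive t 1 g (dg t)) ->
  (forall t, a <= t <= b -> 0 < g t) ->
  measurable_fun `[a, b] (fun t => - dg t / g t : R) /\
  (\int[mu]_(t in `[a, b]) (- dg t / g t)%:E = (ln (g a) - ln (g b))%:E)%E.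
Proof.
move=> ab cg cdg dgP g0.
have cF : {within `[a, b], continuous (fun t => - dg t / g t)}.
  rewrite continuous_subspace_in => t /set_mem tab.
  apply: cvgM; first by apply: cvgN; exact: cdg.
  apply: cvgV; last exact: cg.
  by rewrite gt_eqF// g0//; move: tab; rewrite /= in_itv.
have mF : measurable_fun `[a, b] (fun t => - dg t / g t).
  apply/measurable_EFinP; apply: (@measurable_int _ _ _ mu).
  by apply: continuous_compact_integrable => //; exact: segment_compact.
have [cgo cga cgb] := (continuous_within_itvP _ ab).1 cg.
have derL t : t \in `]a, b[ -> is_derive t 1 (fun t => - ln (g t)) (- dg t / g t).
  rewrite in_itv/= => tab; have g0t : 0 < g t.
    by apply: g0; case/andP: tab => ? ?; rewrite !ltW.
  have := is_derive1_comp (is_derive1_ln g0t) (dgP _ tab).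
  move=> /is_deriveN; rewrite mulNr mulrC; exact.
have cln (t : R) : 0 < g t -> {for g t, continuous (@ln R)} by move=> ?; exact: continuous_ln.
have LR : derivable_oo_LRcontinuous (fun t => - ln (g t)) a b.
  split.
  - by move=> t /derL[].
  - apply: cvgN; apply: (continuous_cvg _ _ cga); apply: cln; apply: g0; rewrite lexx ltW//.
  - apply: cvgN; apply: (continuous_cvg _ _ cgb); apply: cln; apply: g0; rewrite lexx ltW//.
have dE : {in `]a, b[, derive1 (fun t => - ln (g t)) =1 (fun t => - dg t / g t)}.
  by move=> t /derL[_ dE]; rewrite derive1E dE.
split => //; rewrite (continuous_FTC2 ab cF LR dE) -EFinB opprK addrC//.
Qed.

End Calculus.

(** * Upper bounds by measurable majorants *)

Section Majorant.
Context {R : realType}.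
Notation mu := (@lebesgue_measure R).
Implicit Types (F : R -> R) (A B : set R) (u v : R).

(* Upper bounds go through a measurable majorant, because the length integrand
   of a timelike curve is not known to be measurable and the integral is additive
   in its domain only for measurable functions. *)
Definition majorized F A v := exists h : R -> \bar R,
  [/\ measurable_fun A h, forall t, A t -> ((F t)%:E <= h t)%E &
      (\int[mu]_(t in A) h t = v%:E)%E].

Lemma majorizedU F A B u v : measurable A -> measurable B -> [disjoint A & B] ->
  (forall t, (A `|` B) t -> 0 <= F t) ->
  majorized F A u -> majorized F B v -> majorized F (A `|` B) (u + v).
Proof.
move=> mA mB AB F0 [h [mh Fh hu]] [k [mk Fk kv]].
pose l t := if t \in A then h t else k t.
have lA t : A t -> l t = h t by move=> At; rewrite /l mem_set.
have lB t : B t -> l t = k t.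
  move=> Bt; rewrite /l ifN//; apply/negP => /set_mem At.
  by move/disj_setPS: AB => /(_ t); apply.
have Fl t : (A `|` B) t -> ((F t)%:E <= l t)%E.
  by move=> [At|Bt]; [rewrite lA//; exact: Fh|rewrite lB//; exact: Fk].
have ml : measurable_fun (A `|` B) l.
  apply/measurable_funU => //; split.
  - by apply: eq_measurable_fun mh => t /set_mem/lA.
  - by apply: eq_measurable_fun mk => t /set_mem/lB.
exists l; split => //.
rewrite ge0_integral_setU//; last first.
  by move=> t ABt; apply: le_trans (Fl _ ABt); rewrite lee_fin F0.
rewrite EFinD -hu -kv; congr (_ + _)%E; apply: eq_integral => t /set_mem.
- exact: lA.
- exact: lB.
Qed.

(** Serves for break points, where the value of the length integrand is uncontrolled but finite. *)
Lemma majorized_set1 F r : majorized F [set r] 0.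
Proof.
exists (cst (F r)%:E); split; first exact: measurable_cst.
- by move=> t ->.
- by rewrite integral_set1.
Qed.

Lemma majorized_lower_integral F A v : (forall t, A t -> 0 <= F t) ->
  majorized F A v -> (\int[mu]_(t in A) (F t)%:E <= v%:E)%E.
Proof.
move=> F0 [h [_ Fh <-]]; exact: ge0_le_lower_integral.
Qed.

End Majorant.

(** * One-sided derivatives of curves *)

Section Curve.
Context {R : realType} {n : nat}.
Implicit Types (s : R -> 'rV[R]_n) (a b t : R) (v w : 'rV[R]_n).

Lemma cvg_difference_quotient s t v :
  has_right_derivative s t v -> has_left_derivative s t v ->
  h^-1 *: (s (t + h) - s t) @[h --> 0^'] --> v.
Proof.
move=> sr sl V Vv; pose f h := h^-1 *: (s (t + h) - s t).
have Vr : \forall h \near nbhs (0 : R), 0 < h -> V (f h) := sr _ Vv.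
have Vl : \forall h \near nbhs (0 : R), h < 0 -> V (f h) := sl _ Vv.
suff : \forall h \near nbhs (0 : R), h != 0 -> V (f h) by [].
by apply: filterS2 Vr Vl => h hr hl; rewrite neq_lt => /orP[/hl|/hr].
Qed.

Lemma derive1_curve s t v :
  has_right_derivative s t v -> has_left_derivative s t v -> derive1 s t = v.
Proof.
move=> sr sl; apply: cvg_lim; first exact: norm_hausdorff.
under eq_cvg do rewrite [_ + t]addrC.
exact: cvg_difference_quotient.
Qed.

Lemma is_derive_support s t v w c :
  has_right_derivative s t v -> has_left_derivative s t v ->
  is_derive t 1 (fun t => c - dotp w (s t)) (- dotp w v).
Proof.
move=> sr sl; pose g := fun t => c - dotp w (s t).
have gv : h^-1 *: ((g \o shift t) (h *: 1) - g t) @[h --> 0^'] --> - dotp w v.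
  have -> : (fun h => h^-1 *: ((g \o shift t) (h *: 1) - g t)) =
      - (fun h => dotp w (h^-1 *: (s (t + h) - s t))).
    apply/funext => h; transitivity (- dotp w (h^-1 *: (s (t + h) - s t))); last by [].
    rewrite /= [h *: 1]mulr1 [h + t]addrC /g dotpZr dotpBr /GRing.scale/=; ring.
  exact: (cvgN (cvg_dotp (cvg_cst w) (cvg_difference_quotient sr sl))).
split; first by apply/cvg_ex; exists (- dotp w v).
exact: cvg_lim.
Qed.

End Curve.

(** * Upper bound for the length of a timelike curve *)

Section UpperBound.
Context {R : realType} {n : nat} {I1 I2 : set 'rV[R]_n}.
Hypothesis I2_open : open I2.
Variables (w : 'rV[R]_n) (c : R).
Hypothesis supp : supporting_hyperplane I2 w c.
Hypothesis vis : hyperplane w c `&` visible_part I1 I2 !=set0.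
Variable sigma : R -> 'rV[R]_n.
Hypothesis sigma_timelike : timelike_curve I1 I2 sigma.

(** Proportional to the signed distance to the hyperplane, positive on the side away from [I2]. *)
Let g t := c - dotp w (sigma t).
Let F t := Funk_functional I1 I2 (sigma t) (derive1 sigma t).

Let continuous_g a b : 0 <= a -> b <= 1 -> {within `[a, b], continuous g}.
Proof.
move=> a0 b1; case: sigma_timelike => -[cs _] _ _ _.
have {}cs : {within `[a, b], continuous sigma}.
  apply: continuous_subspaceW cs => t /=; rewrite !in_itv/= => /andP[at_ tb].
  by rewrite (le_trans a0)// (le_trans tb).
move=> t; apply: cvgB; first exact: cvg_cst.
exact: (cvg_dotp (cvg_cst w) (cs t)).
Qed.

(** Positivity of [g] spreads backwards from [b], since [g] cannot increase where it is positive.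
    The functional is then at most [- g' / g]; the open interval avoids break points. *)
Lemma timelike_piece a b : 0 <= a -> a < b -> b <= 1 -> C1_on a b sigma ->
  0 < g b ->
  (forall t, a <= t <= b -> 0 < g t) /\ majorized F `]a, b[ (ln (g a) - ln (g b)).
Proof.
move=> a0 ab b1 [ds [cds dsr dsl]] gb.
have dr t : a < t < b -> has_right_derivative sigma t (ds t).
  by move=> /andP[at_ tb]; apply: dsr; rewrite ltW.
have dl t : a < t < b -> has_left_derivative sigma t (ds t).
  by move=> /andP[at_ tb]; apply: dsl; rewrite at_ ltW.
have dg t : a < t < b -> is_derive t 1 g (- dotp w (ds t)).
  by move=> tab; exact: is_derive_support (dr _ tab) (dl _ tab).
have cone t : a < t < b -> future_cone I1 I2 (sigma t) (ds t).
  move=> /[dup] /andP[at_ tb] /dr; case: sigma_timelike => _ _ + _; apply.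
  by rewrite (le_trans a0) ?(lt_le_trans tb)// ltW.
have wds t : a < t < b -> 0 < g t -> 0 <= dotp w (ds t).
  move=> tab; rewrite subr_gt0 => gt0.
  exact: (future_cone_support I2_open supp gt0 (cone _ tab)).
have cg := continuous_g a0 b1.
have gpos : forall t, a <= t <= b -> 0 < g t.
  by apply: (gt0_backwards ab cg dg gb) => t tab /(wds _ tab); rewrite oppr_le0.
split => //.
have cdg : {within `[a, b], continuous (fun t => - dotp w (ds t))}.
  move=> t; apply: cvgN; exact: (cvg_dotp (cvg_cst w) (cds t)).
have [mh hE] := integral_logarithmic_derivative ab cg cdg dg gpos.
exists (EFin \o (fun t => - - dotp w (ds t) / g t)); split.
- by apply/measurable_EFinP; apply: measurable_funS mh => //; exact: subset_itv_oo_cc.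
- move=> t; rewrite /= in_itv/= lee_fin opprK => tab.
  have gt0 : 0 < g t by apply: gpos; case/andP: tab => ? ?; rewrite !ltW.
  rewrite /F (derive1_curve (dr _ tab) (dl _ tab)).
  by apply: Funk_functional_le => //; [rewrite -subr_gt0|exact: wds].
- rewrite -hE -[RHS]integral_itv_obnd_cbnd; last first.
    by apply/measurable_EFinP; apply: measurable_funS mh => //; exact: subset_itv_oc_cc.
  rewrite -[RHS]integral_itv_bndo_bndc//.
  by apply/measurable_EFinP; apply: measurable_funS mh => //; exact: subset_itv_oo_cc.
Qed.

Lemma timelike_length_le : dotp w (sigma 1) < c ->
  (curve_length I1 I2 sigma <=
   (ln (c - dotp w (sigma 0)) - ln (c - dotp w (sigma 1)))%:E)%E.
Proof.
rewrite -subr_gt0 => g1; case: (sigma_timelike) => -[_ [m [x [x0 xm xP]]]] _ _ _.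
have x_ge0 i : (i <= m)%N -> 0 <= x i.
  elim: i => [|i IH] im; first by rewrite x0.
  by apply: le_trans (IH (ltnW im)) (ltW (xP _ im).1).
have x_le1 j : (j <= m)%N -> x (m - j)%N <= 1.
  elim: j => [|j IH] jm; first by rewrite subn0 xm.
  apply: le_trans (IH (ltnW jm)).
  have mj : (m - j.+1 < m)%N by rewrite ltn_subrL//; case: (m) jm.
  by have [/ltW] := xP _ mj; rewrite subnSK.
have {}x_le1 i : (i <= m)%N -> x i <= 1.
  by move=> im; have := x_le1 _ (leq_subr i m); rewrite subKn.
(* Induction down from the last break point, because positivity is known at the end of the curve. *)
have gx j : (j <= m)%N -> 0 < g (x (m - j)%N).
  elim: j => [|j IH] jm; first by rewrite subn0 xm.
  have mj : (m - j.+1 < m)%N by rewrite ltn_subrL//; case: (m) jm.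
  have [xx C1] := xP _ mj; have := IH (ltnW jm); rewrite -(subnSK jm) => gj.
  have [+ _] := timelike_piece (x_ge0 _ (ltnW mj)) xx (x_le1 _ mj) C1 gj.
  by apply; rewrite lexx ltW.
have {}gx i : (i <= m)%N -> 0 < g (x i).
  by move=> im; have := gx _ (leq_subr i m); rewrite subKn.
have F0 t : 0 <= F t by exact: Funk_functional_ge0.
(* The bounds on the pieces telescope; each new break point is split off and contributes 0. *)
have maj i : (i <= m)%N -> majorized F `[0, x i] (ln (g 0) - ln (g (x i))).
  elim: i => [|i IH] im; first by rewrite x0 set_itv1 subrr; exact: majorized_set1.
  have [xx C1] := xP _ im.
  have [_ mi] := timelike_piece (x_ge0 _ (ltnW im)) xx (x_le1 _ im) C1 (gx _ im).
  have -> : ln (g 0) - ln (g (x i.+1)) =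
      ln (g 0) - ln (g (x i)) + (ln (g (x i)) - ln (g (x i.+1)) + 0) by ring.
  have -> : `[0, x i.+1]%classic = `[0, x i] `|` (`]x i, x i.+1[ `|` [set x i.+1]).
    have xi0 := x_ge0 _ (ltnW im).
    apply/seteqP; split => t /=; rewrite !in_itv/=.
      move=> /andP[t0 tx]; have [txi|xit] := leP t (x i); first by left; rewrite t0.
      by right; have [->|tN] := eqVneq t (x i.+1); [right|left; rewrite lt_neqAle tN].
    move=> [/andP[-> txi]|[/andP[xit txi]|->]].
    - by rewrite (le_trans txi)// ltW.
    - by rewrite (ltW txi) (le_trans xi0)// ltW.
    - by rewrite lexx (le_trans xi0)// ltW.
  apply: majorizedU => //; first exact: measurableU.
  - apply/disj_setPS => t /=; rewrite !in_itv/= => -[/andP[_ txi]] [/andP[xit _]|tE].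
      by move: txi; rewrite leNgt xit.
    by move: txi; rewrite tE leNgt xx.
  - exact: IH (ltnW im).
  apply: majorizedU => //; last exact: majorized_set1.
  by apply/disj_setPS => t /=; rewrite in_itv/= => -[/andP[_ +]] tE; rewrite tE ltxx.
have := maj _ (leqnn m); rewrite xm => /majorized_lower_integral; exact.
Qed.

End UpperBound.

(** * The straight segment as a maximizing curve *)

Section StraightLine.
Context {R : realType} {n : nat} {I1 I2 : set 'rV[R]_n}.
Hypothesis I1_open : open I1.
Hypothesis I2_open : open I2.
Hypothesis I2_neq0 : I2 !=set0.
Hypothesis I2_convex : is_convex I2.
Hypothesis I12_disjoint : I1 `&` I2 = set0.
Hypothesis K12_disjoint : boundary I1 `&` boundary I2 = set0.
Variables (a1 a2 : 'rV[R]_n) (s t : R).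
Hypothesis adm : admissible I1 I2 a1 a2.
Hypotheses (s_gt0 : 0 < s) (st : s <= t) (t_lt1 : t < 1).

(** For [s = t] the curve is constant, which covers [p = q]. *)
Let sigma (r : R) : 'rV[R]_n := a1 + (s + r * (t - s)) *: (a2 - a1).
Let v := (t - s) *: (a2 - a1).

Let param01 r : 0 <= r <= 1 -> 0 < s + r * (t - s) < 1.
Proof.
move=> /andP[r0 r1]; rewrite ltr_wpDr ?mulr_ge0 ?subr_ge0//=.
by apply: le_lt_trans t_lt1; rewrite -lerBrDl ler_piMl// subr_ge0.
Qed.

Let quotient r h : h != 0 -> h^-1 *: (sigma (r + h) - sigma r) = v.
Proof.
move=> h0; have -> : sigma (r + h) - sigma r = h *: v.
  by apply/rowP => i; rewrite !mxE; ring.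
by rewrite scalerA mulVf// scale1r.
Qed.

Let right_derivative r : has_right_derivative sigma r v.
Proof.
move=> V Vv; apply: (@nearW _ (nbhs (0 : R))) => h h0 /=.
by rewrite quotient ?gt_eqF//; exact: nbhs_singleton.
Qed.

Let left_derivative r : has_left_derivative sigma r v.
Proof.
move=> V Vv; apply: (@nearW _ (nbhs (0 : R))) => h h0 /=.
by rewrite quotient ?lt_eqF//; exact: nbhs_singleton.
Qed.

Let continuous_sigma : continuous sigma.
Proof.
move=> r; apply: cvgD; first exact: cvg_cst.
apply: cvgZl; apply: cvgD; first exact: cvg_cst.
by apply: cvgMl; exact: (@cvg_id _ (nbhs r)).
Qed.

Let future_cone_sigma r : 0 <= r <= 1 -> future_cone I1 I2 (sigma r) v.
Proof.
move=> r01; have /andP[p0 p1] := param01 r01.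
move: st; rewrite le_eqVlt => /orP[/eqP ts|st'].
  by left; rewrite /v ts subrr scale0r.
have d0 : a2 - a1 != 0 by rewrite subr_eq0 eq_sym (admissible_neq K12_disjoint adm).
have v0 : v != 0 by rewrite scaler_eq0 negb_or d0 subr_eq0 gt_eqF.
right; split => //; set u := s + _ in p0 p1.
(* Moving by [e *: v] leads to the parameter [u'], halfway between [u] and 1. *)
pose e := (1 - u) / (2 * (t - s)).
have e0 : 0 < e by rewrite divr_gt0 ?mulr_gt0// subr_gt0.
pose u' := u + (1 - u) / 2.
have uE : u + e * (t - s) = u'.
  by rewrite /e invfM mulrA divfK// subr_eq0 gt_eqF.
have qE : sigma r + e *: v = a1 + u' *: (a2 - a1).
  by rewrite /sigma -/u /v scalerA -addrA -scalerDl uE.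
have uu' : u < u' by rewrite ltrDl divr_gt0// subr_gt0.
have u'1 : u' < 1 by rewrite -ltrBrDl ltr_pdivrMr// mulr_natr mulr2n ltrDl subr_gt0.
exists e; split => //; rewrite qE; split.
  by exists a1, a2; split => //; exists u'; rewrite (lt_trans p0).
split.
  by apply/eqP => /addrI/eqP; rewrite -subr_eq0 -scalerBl scaler_eq0 (negbTE d0) orbF
     subr_eq0 lt_eqF.
by exists a1, a2, u, u'; split.
Qed.

Lemma straight_timelike : timelike_curve I1 I2 sigma.
Proof.
split.
- split; first exact: continuous_subspaceT.
  exists 1%N, (fun i => i%:R); split => // i; rewrite ltnS leqn0 => /eqP->.
  split; first exact: ltr01.
  exists (cst v); split => [|r _|r _] //.
  by apply: continuous_subspaceT => r; exact: cvg_cst.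
- move=> r r01; exists a1, a2; split => //.
  by exists (s + r * (t - s)); split => //; exact: param01.
- move=> r v' /andP[r0 r1] dv'; have -> : v' = v.
    exact: (cvg_unique _ dv' (right_derivative r)).
  by apply: future_cone_sigma; rewrite r0 ltW.
- move=> r v' /andP[r0 r1] dv'; have -> : v' = v.
    exact: (cvg_unique _ dv' (left_derivative r)).
  by apply: future_cone_sigma; rewrite r1 ltW.
Qed.

Lemma straight_length :
  curve_length I1 I2 sigma = (ln ((1 - s) / (1 - t)))%:E.
Proof.
(* The fraction of the segment left before [a2]; the functional along the curve is
   [(t - s) / g r]. *)
pose g r := 1 - (s + r * (t - s)).
have g0 r : 0 <= r <= 1 -> 0 < g r by move=> /param01/andP[_]; rewrite subr_gt0.
have dgP (r : R) : 0 < r < 1 -> is_derive r 1 g (- (t - s)).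
  move=> _; rewrite /g; apply: is_derive_eq.
  by rewrite scaler0 !add0r /GRing.scale/= mulr1 mul1r mul1r.
have cg : {within `[0, 1], continuous g}.
  apply: continuous_subspaceT => r; apply: cvgB; first exact: cvg_cst.
  apply: cvgD; first exact: cvg_cst.
  by apply: cvgMl; exact: (@cvg_id _ (nbhs r)).
have cdg : {within `[0, 1], continuous (fun _ : R => - (t - s))}.
  by apply: continuous_subspaceT => r; exact: cvg_cst.
have [_ gE] := integral_logarithmic_derivative ltr01 cg cdg dgP g0.
rewrite lnM ?posrE ?invr_gt0 ?subr_gt0 ?(le_lt_trans st)// lnV ?posrE ?subr_gt0//.
have <- : g 0 = 1 - s by rewrite /g mul0r addr0.
have <- : g 1 = 1 - t by rewrite /g mul1r [s + _]addrC subrK.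
rewrite -gE; apply: eq_integral => r /set_mem; rewrite /= in_itv/= => r01.
rewrite (derive1_curve (right_derivative r) (left_derivative r)) opprK.
congr EFin; apply: Funk_functional_admissible => //.
- by have /andP[] := param01 r01.
- by rewrite subr_ge0.
Qed.

End StraightLine.

(** * Equality of the Funk and intrinsic distances *)

Unset Implicit Arguments.

Theorem theorem7p4 (R : realType) (n : nat) (I1 I2 : set 'rV[R]_n)
    (I1_neq0 : I1 !=set0) (I2_neq0 : I2 !=set0)
    (I1_open : open I1) (I2_open : open I2)
    (I1_convex : @convex_set R 'rV[R]_n I1)
    (I2_convex : @convex_set R 'rV[R]_n I2)
    (I12_disjoint : I1 `&` I2 = set0)
    (K12_disjoint : boundary I1 `&` boundary I2 = set0)
    (p q : 'rV[R]_n) (Omega_p : Omega I1 I2 p) (Omega_q : Omega I1 I2 q)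
    (le_pq : precedes_eq I1 I2 p q) :
  (relative_Funk I2 p q)%:E = intrinsic_distance I1 I2 p q.
Proof.
have cI2 := convex_set_is_convex I2_convex.
(* Both cases of [le_pq] are treated at once: for [p = q], [Omega_p] provides a segment with
   [s = t]. *)
have [a1 [a2 [s [t [adm [s0 st t1] -> ->]]]]] : exists a1 a2 s t,
    [/\ admissible I1 I2 a1 a2, [/\ 0 < s, s <= t & t < 1],
        p = a1 + s *: (a2 - a1) & q = a1 + t *: (a2 - a1)].
  case: le_pq => [[_ [a1 [a2 [s [t [[adm s0 st t1] [pE qE]]]]]]]|<-].
    by exists a1, a2, s, t; split => //; split => //; exact: ltW.
  have [a1 [a2 [adm [s [/andP[s0 s1] pE]]]]] := Omega_p.
  by exists a1, a2, s, s; split.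
rewrite (relative_Funk_admissible K12_disjoint adm)//.
apply/eqP; rewrite eq_le; apply/andP; split.
  apply: ereal_sup_ubound; exists (fun r => a1 + (s + r * (t - s)) *: (a2 - a1)).
    split; first exact: straight_timelike.
    - by rewrite mul0r addr0.
    - by rewrite mul1r [s + _]addrC subrK.
  exact: straight_length.
have [w [c [supp vis wc wd]]] :=
  admissible_support I1_open I2_open I2_neq0 cI2 I12_disjoint K12_disjoint adm.
(* The factor [dotp w (a2 - a1)] cancels in the final difference of logarithms. *)
have cE r : c - dotp w (a1 + r *: (a2 - a1)) = (1 - r) * dotp w (a2 - a1).
  by rewrite -wc !dotp_linE; ring.
apply: ge_ereal_sup => _ [sigma [tl sigma0 sigma1] <-].
have := timelike_length_le I2_open supp vis tl; rewrite sigma0 sigma1 !cE.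
rewrite -subr_gt0 cE => /(_ (mulr_gt0 _ wd)); rewrite subr_gt0 => /(_ t1).
have s1 := le_lt_trans st t1.
by rewrite -ln_div ?posrE ?mulr_gt0 ?subr_gt0// -mulf_div divff ?mulr1// gt_eqF.
Qed.
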